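(* Let $F$ be a surjective closed relation on a compact metric space $X$. (a) If $G \subset \mathcal{S}_+(F)$ is inward for the shift map $S$, then there exist $U \subset X$ inward for $F$ and a positive integer $N$ such that $S^N(G) \subset\subset \pi_0^{-1}(U) \subset\subset G$. If $A = \bigcap_{k=1}^{\infty} F^k(U)$ is the associated attractor for $U$, then $\pi_0^{-1}(A) = \bigcap_{k=1}^{\infty} S^k(G)$ is the associated attractor for $G$. (b) If $G \subset \mathcal{S}(F)$ is inward for the shift homeomorphism $S$, then there exist $U \subset X$ inward for $F$ and positive integers $N, m$ such that $S^N(G) \subset\subset \pi_{-m}^{-1}(U) \subset\subset G$. If $A = \bigcap_{k=1}^{\infty} F^k(U)$ is the associated attractor for $U$, then the associated attractor for $G$ is $\mathcal{S}(F_A)$, the subspace of all bi-infinite orbit sequences contained in $A$. (c) If $X$ is chain transitive for $F$, then each of $\mathcal{S}_+(F)$ and $\mathcal{S}(F)$ is chain transitive for the corresponding shift map. (d) If $B \subset X$ is minimal for $F$, then there exist unique $A_+ \subset \mathcal{S}_+(F_B)$ and $A \subset \mathcal{S}(F_B)$ which are the unique minimal subsets (for the shift $S$) of $\mathcal{S}_+(F)$ and $\mathcal{S}(F)$, respectively, which are mapped onto $B$ by the projections $\pi_0$.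
   Context: A relation $F$ on $X$ is a subset of $X\times X$, closed if it is a closed subset; $F(x)=\{y:(x,y)\in F\}$, $F(A)=\bigcup_{x\in A}F(x)$, $F^{-1}=\{(y,x):(x,y)\in F\}$, $F^n$ the $n$-fold composition. A continuous map is regarded as the closed relation given by its graph. $F$ is surjective if $F(X)=X=F^{-1}(X)$. $F_B=F\cap(B\times B)$. $A\subset\subset B$ means $\overline A\subset B^\circ$ (closure and interior in the ambient space). $\mathcal{S}_+(F)=\{\mathbf{x}\in X^{\mathbb{Z}_+}:\mathbf{x}(n+1)\in F(\mathbf{x}(n)) \text{ for all } n\in \mathbb{Z}_+\}$ ($\mathbb{Z}_+$ the nonnegative integers) and $\mathcal{S}(F)=\{\mathbf{x}\in X^{\mathbb{Z}}:\mathbf{x}(n+1)\in F(\mathbf{x}(n))\text{ for all } n\in\mathbb{Z}\}$, with the product topology (compact metrizable). The shift is $S(\mathbf{x})(n)=\mathbf{x}(n+1)$, and $\pi_n(\mathbf{x})=\mathbf{x}(n)$ restricted to these spaces. $\pi_n^{-1}(U)$ is the preimage in the relevant solution space. A closed set $U$ is inward for $F$ if $F(U)\subset\subset U$; its associated attractor is $\bigcap_{k\ge1}F^k(U)$. $\mathcal{O}F=\bigcup_{n\ge1}F^n$, $V_\epsilon=\{(x,y):d(x,y)<\epsilon\}$, and $\mathcal{C}F=\bigcap_{\epsilon>0}\mathcal{O}(V_\epsilon\circ F)$; $X$ is chain transitive for $F$ if $\mathcal{C}F=X\times X$. A closed set $B$ is viable for $F$ if $B\subset F(B)\cap F^{-1}(B)$.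 A nonempty closed set is minimal for $F$ if it is viable and contains no proper nonempty closed viable subset. *)

(* Defs.v *)
From HB Require Import structures.
From mathcomp Require Import all_boot all_order all_algebra.
From mathcomp Require Import all_classical all_reals all_analysis.
From mathcomp Require Import lra.

Set Implicit Arguments.
Unset Strict Implicit.
Unset Printing Implicit Defensive.

Import Order.TTheory GRing.Theory Num.Theory.

Local Open Scope classical_set_scope.

Local Open Scope ring_scope.

(** The library's [B \; A] on relations applies [A] first: it is the usual
    [B o A], despite the convention of [\;] on functions. *)

Definition rel_image {T : Type} (F : set (T * T)) (A : set T) : set T :=
  \bigcup_(x in A) xsection F x.

Definition rel_surjective {T : Type} (F : set (T * T)) : Prop :=
  rel_image F [set: T] = [set: T] /\ rel_image (F^-1)%relation [set: T] = [set: T].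

Definition rel_pow {T : Type} (F : set (T * T)) (n : nat) : set (T * T) :=
  iter n (fun H => (F \; H)%relation) diagonal.

Definition rel_restr {T : Type} (F : set (T * T)) (B : set T) : set (T * T) :=
  F `&` B `*` B.

Definition map_rel {T : Type} (f : T -> T) : set (T * T) :=
  [set xy | xy.2 = f xy.1].

Definition rel_orbit {T : Type} (F : set (T * T)) : set (T * T) :=
  \bigcup_(n in [set n | (0 < n)%N]) rel_pow F n.

Definition well_inside {T : topologicalType} (A B : set T) : Prop :=
  closure A `<=` interior B.

Definition inward {T : topologicalType} (F : set (T * T)) (U : set T) : Prop :=
  closed U /\ well_inside (rel_image F U) U.

Definition attractor {T : Type} (F : set (T * T)) (U : set T) : set T :=
  \bigcap_(k in [set k | (0 < k)%N]) rel_image (rel_pow F k) U.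

Definition viable {T : topologicalType} (F : set (T * T)) (B : set T) : Prop :=
  closed B /\ B `<=` rel_image F B `&` rel_image (F^-1)%relation B.

Definition minimal {T : topologicalType} (F : set (T * T)) (B : set T) : Prop :=
  [/\ B !=set0, viable F B &
      forall C : set T, C !=set0 -> viable F C -> C `<=` B -> C = B].

(** Chains, with respect to a distance [d]. *)

Definition dist_rel {R : realType} {T : Type} (d : T -> T -> R) (e : R) :
  set (T * T) := [set xy | d xy.1 xy.2 < e].

Definition chain_rel {R : realType} {T : Type} (d : T -> T -> R)
    (F : set (T * T)) : set (T * T) :=
  \bigcap_(e in [set e : R | 0 < e]) rel_orbit (dist_rel d e \; F)%relation.

Definition chain_transitive {R : realType} {T : Type} (d : T -> T -> R)
    (F : set (T * T)) : Prop :=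
  chain_rel d F = [set: T * T].

Definition compatible_metric {R : realType} {T : topologicalType}
    (d : T -> T -> R) : Prop :=
  [/\ forall x y, (d x y = 0) <-> (x = y),
      forall x y, d x y = d y x,
      forall x y z, d x z <= d x y + d y z &
      forall (x : T) (A : set T), nbhs x A <->
        (exists2 e : R, 0 < e & [set y | d x y < e] `<=` A)].

(** Solution spaces: sets of sequences, used below as types through the
    coercion [set_type], whose topology is the subspace topology of the
    product. *)

Definition fwd_orbits {X : topologicalType} (F : set (X * X)) :
  set {ptws nat -> X} := [set x | forall n : nat, F (x n, x n.+1)].

Definition bi_orbits {X : topologicalType} (F : set (X * X)) :
  set {ptws int -> X} := [set x | forall n : int, F (x n, x (n + 1))].

Definition fwd_proj {X : topologicalType} (F : set (X * X)) (n : nat)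
  (x : fwd_orbits F) : X := (set_val x : {ptws nat -> X}) n.

Definition bi_proj {X : topologicalType} (F : set (X * X)) (n : int)
  (x : bi_orbits F) : X := (set_val x : {ptws int -> X}) n.

Lemma fwd_shift_subproof (X : topologicalType) (F : set (X * X))
    (x : fwd_orbits F) :
  ((fun n => fwd_proj n.+1 x) : {ptws nat -> X}) \in fwd_orbits F.
Proof. by apply/mem_set => n; exact: (set_valP x n.+1). Qed.

Definition fwd_shift {X : topologicalType} (F : set (X * X))
    (x : fwd_orbits F) : fwd_orbits F :=
  SigSub (fwd_shift_subproof x).

Lemma bi_shift_subproof (X : topologicalType) (F : set (X * X))
    (x : bi_orbits F) :
  ((fun n => bi_proj (n + 1) x) : {ptws int -> X}) \in bi_orbits F.
Proof. by apply/mem_set => n; exact: (set_valP x (n + 1)). Qed.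

Definition bi_shift {X : topologicalType} (F : set (X * X))
    (x : bi_orbits F) : bi_orbits F :=
  SigSub (bi_shift_subproof x).

Arguments fwd_proj {X} F n x.
Arguments bi_proj {X} F n x.
Arguments fwd_shift {X} F x.
Arguments bi_shift {X} F x.

(** [compatible_metric] is inhabited on the solution spaces, and [mdist] is
    compatible with the topology of a [metricType]. *)

Lemma mdist_compatible (R : realType) (X : metricType R) :
  compatible_metric (@mdist R X).
Proof.
split=> [x y|x y|x y z|x A].
- split; [exact: mdist_positivity|by move=> ->; rewrite mdistxx].
- exact: metric_sym.
- exact: metric_triangle.
- rewrite -nbhs_ballE; split=> [[e /= e0 eA]|[e e0 eA]]; exists e => //.
    by rewrite -ballEmdist.
  by rewrite ballEmdist.
Qed.

Section product_metric.
Context {R : realType} {X : metricType R} {I : countType}.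
Variable D : set {ptws I -> X}.

Let cut (i : I) : R := (pickle i).+1%:R^-1.

Let cut_gt0 i : 0 < cut i. Proof. by rewrite invr_gt0 ltr0n. Qed.

Let term (x y : D) (i : I) : R :=
  Order.min (mdist ((set_val x : {ptws I -> X}) i)
                 ((set_val y : {ptws I -> X}) i)) (cut i).

Let term_ge0 x y i : 0 <= term x y i.
Proof. by rewrite le_min mdist_ge0 ltW. Qed.

Let term_le1 x y i : term x y i <= 1.
Proof. rewrite ge_min; apply/orP; right.
by rewrite -[leRHS]invr1 lef_pV2 ?posrE ?ltr0n// ler1n. Qed.

Let terms (x y : D) : set R := 0 |` range (term x y).

Let terms_ub x y : has_sup (terms x y).
Proof.
split; first by exists 0; left.
by exists 1 => _ [->|[i _ <-]]; [exact: ler01|exact: term_le1].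
Qed.

Let dist (x y : D) : R := sup (terms x y).

Let term_dist x y i : term x y i <= dist x y.
Proof. by apply: (sup_upper_bound (terms_ub x y)); right; exists i. Qed.

Let dist_ge0 x y : 0 <= dist x y.
Proof. by apply: (sup_upper_bound (terms_ub x y)); left. Qed.

Let dist_le x y (c : R) :
  0 <= c -> (forall i, term x y i <= c) -> dist x y <= c.
Proof.
move=> c0 H; apply: ge_sup; first by exists 0; left.
by move=> _ [->//|[i _ <-]].
Qed.

Let ball_nbhs (x : D) (e : R) : 0 < e -> nbhs x [set y | dist x y < e].
Proof.
move=> e0.
have e20 : 0 < e / 2 by rewrite divr_gt0.
have [n _ ne] : exists2 n : nat, True & n.+1%:R^-1 < e / 2.
  by have [n ne] := ltr_add_invr e20; exists n => //; rewrite add0r in ne.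
have near_i (i : I) : nbhs x [set y | term x y i <= e / 2].
  have cproj : continuous (fun y : D => (set_val y : {ptws I -> X}) i).
    move=> y; apply: (@continuous_comp _ _ _ (set_val : D -> {ptws I -> X})
      (fun z : {ptws I -> X} => z i)).
      exact: (@initial_continuous D {ptws I -> X} set_val).
    exact: (@proj_continuous I (fun=> X) i).
  have H : nbhs x [set y : D | ball ((set_val x : {ptws I -> X}) i) (e / 2)
      ((set_val y : {ptws I -> X}) i)].
    exact: (cproj x _ (nbhsx_ballx _ _ e20)).
  move: H; apply: filterS => y /=.
  by rewrite ballEmdist /= => H; rewrite ge_min ltW.
have near_n : nbhs x [set y | forall i, (pickle i < n)%N -> term x y i <= e / 2].
  elim: n {ne} => [|n IH]; first by apply: filterE => y i.
  case E : (@pickle_inv I n) => [j|].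
    apply: filterS2 IH (near_i j) => y IH Hj i; rewrite ltnS leq_eqVlt.
    case/orP => [/eqP ijn|]; last exact: IH.
    by move: E; rewrite -ijn pickleK_inv => -[->].
  apply: filterS IH => y IH i; rewrite ltnS leq_eqVlt.
  case/orP => [/eqP ijn|]; last exact: IH.
  by move: E; rewrite -ijn pickleK_inv.
apply: filterS near_n => y Hy /=.
apply: (@le_lt_trans _ _ (e / 2)); last by rewrite ltr_pdivrMr// ltr_pMr// ltr1n.
apply: dist_le; first exact: ltW.
move=> i; case: (ltnP (pickle i) n) => [|ni]; first exact: Hy.
rewrite ge_min; apply/orP; right; apply: (le_trans _ (ltW ne)).
by rewrite lef_pV2 ?posrE ?ltr0n// ler_nat.
Qed.

Let nbhs_ball (x : D) (A : set D) : nbhs x A ->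
  exists2 e : R, 0 < e & [set y | dist x y < e] `<=` A.
Proof.
pose N : set_system {ptws I -> X} := [set B | exists2 e : R, 0 < e &
  [set y | dist x y < e] `<=` set_val @^-1` B].
have FN : Filter N.
  split.
  - by exists 1.
  - move=> P Q [e e0 eP] [e' e'0 eQ]; exists (Num.min e e').
      by rewrite lt_min e0.
    by move=> y /=; rewrite lt_min => /andP[ye ye']; split; [exact: eP|exact: eQ].
  - by move=> P Q PQ [e e0 eP]; exists e => // y /eP; exact: PQ.
have Nx : N --> (set_val x : {ptws I -> X}).
  apply/cvg_sup => i B.
  case=> [_ [[W oW <-] Wx] WB].
  have : nbhs ((set_val x : {ptws I -> X}) i) W by apply: open_nbhs_nbhs.
  rewrite -nbhs_ballE => -[e /= e0 eW].
  exists (Num.min e (cut i)); first by rewrite lt_min e0 cut_gt0.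
  move=> y /= ye; apply: WB; apply: eW; rewrite ballEmdist /=.
  have := le_lt_trans (term_dist x y i) ye.
  rewrite lt_min !gt_min ltxx orbF => /andP[/orP[//|ce] dc].
  exact: lt_trans dc ce.
rewrite nbhsE /= => -[_ [[W oW <-] Wx] WA].
have [e e0 eW] : N W by apply: Nx; apply: open_nbhs_nbhs.
by exists e => // y /eW; exact: WA.
Qed.

Lemma product_metric_ex : exists d : D -> D -> R, compatible_metric d.
Proof.
exists dist; split=> [x y|x y|x y z|x A].
- split=> [d0|->].
    apply: val_inj; apply/funext => i; apply: mdist_positivity.
    apply/eqP; rewrite eq_le mdist_ge0 andbT.
    have := term_dist x y i; rewrite d0 ge_min => /orP[//|].
    by rewrite leNgt cut_gt0.
  apply/eqP; rewrite eq_le dist_ge0 andbT; apply: dist_le => // i.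
  by rewrite ge_min mdistxx lexx.
- have E : term x y = term y x.
    by apply/funext => i; rewrite /term metric_sym.
  by rewrite /dist /terms E.
- apply: dist_le => [|i]; first by rewrite addr_ge0.
  apply: (le_trans _ (lerD (term_dist x y i) (term_dist y z i))).
  have := metric_triangle ((set_val x : {ptws I -> X}) i)
    ((set_val y : {ptws I -> X}) i) ((set_val z : {ptws I -> X}) i).
  have := term_ge0 x y i; have := term_ge0 y z i; rewrite /term.
  move: (mdist _ _) (mdist _ _) (mdist _ _) (cut_gt0 i) => a b c.
  rewrite /Order.min; case: ifP; case: ifP; case: ifP; lra.
- split; first exact: nbhs_ball.
  by case=> e e0 eA; apply: filterS eA (ball_nbhs x e0).
Qed.

End product_metric.

Lemma fwd_orbits_metrizable (R : realType) (X : metricType R)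
    (F : set (X * X)) :
  exists d : fwd_orbits F -> fwd_orbits F -> R, compatible_metric d.
Proof. exact: product_metric_ex. Qed.

Lemma bi_orbits_metrizable (R : realType) (X : metricType R)
    (F : set (X * X)) :
  exists d : bi_orbits F -> bi_orbits F -> R, compatible_metric d.
Proof. exact: product_metric_ex. Qed.

(* Main.v *)
Require Import Defs.
From mathcomp Require Import all_boot all_order all_algebra.
From mathcomp Require Import all_classical all_reals all_analysis.
From mathcomp Require Import zify lra.

Set Implicit Arguments.
Unset Strict Implicit.
Unset Printing Implicit Defensive.

Import Order.TTheory GRing.Theory Num.Theory.
Local Open Scope classical_set_scope.
Local Open Scope ring_scope.

(** The orbit spaces are closed in a product of copies of [X], so they are compact,
    and a compactness argument reduces each claim to finitely many coordinates
    ([window_separates]). The one-sided and the two-sided space are both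
    [orbits s F], for the successor [s] of the index type.

    Attractors. Let [G] be inward for the shift [S]. There is a window such that
    an orbit which agrees on it with a point of [S @` G] is in [G]
    ([inward_window]). Splicing orbits of [F] then shows that membership in a
    high iterate of [G] depends on one coordinate only, up to a
    loss that [G] can afford. Hence the projection [D] of that iterate is forward
    invariant under [F], and it attracts in finitely many steps the open set [W]
    of points whose whole fibre is in the interior of [G]. A closed set that is
    inward for [F] fits between [D] and [W] ([inward_between]), and it is the
    required [U] ([inward_lift]). Once the iterates of [G] and the preimages of
    [U] are interleaved, the attractors are compared orbit by orbit.

    Chains. Orbits of the perturbed relation [jump e] are, on a given window,
    close to orbits of [F] when [e] is small ([shadowing]). Given [x] and [y],
    follow [x], then a chain in [X], then [y]: this is an orbit of [jump e], and
    the shadows of its successive shifts form a chain from [x] to [y]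
    ([pseudo_orbit_chain]).

    Minimal sets. Zorn's lemma gives a minimal set [M] of orbits inside [B], and
    its projection is viable, hence is [B] ([lift_exists]). Uniqueness rests on
    the fact that [F] is nearly single-valued on a minimal set: if [U] is open
    and meets [B], some point of [B] has all its successors in [B] in [U], since
    otherwise one could avoid [U] forever ([minimal_forced]). Iterating, some
    point of [B] has all its orbits in [B] close to each other for any prescribed
    time ([synchronised]). Two lifts of [B] both contain an orbit that starts at
    this point, so they cannot be separated ([lift_unique]). *)

(** * Compactness *)

(** The projection along a compact factor is a closed map. All closedness
    statements about images and composites of relations reduce to it. *)
Lemma closed_snd_image {T U : topologicalType} {C : set (T * U)} :
  compact [set: T] -> closed C -> closed (snd @` C).
Proof.
move=> /compact_near_coveringP ncT cC; rewrite -openC openE => u nCu.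
have : \forall v \near u, [set: T] `<=` (fun t => ~ C (t, v)).
  apply: (ncT U (nbhs u) (fun v t => ~ C (t, v))) => t _.
  have nC : nbhs (t, u) (~` C).
    apply: open_nbhs_nbhs; split; first exact: closed_openC.
    by move=> Ctu; apply: nCu; exists (t, u).
  by apply: filterS nC => -[a b].
apply: filterS => v Hv /= [[t v'] Ctv /= v'E].
by apply: (Hv t) => //; rewrite -v'E.
Qed.

(** Cantor's intersection theorem: a totally ordered family of nonempty closed
    sets generates a proper filter, whose cluster points lie in all of them. *)
Lemma chain_bigcap_nonempty {T : topologicalType} {P : set (set T)} :
  compact [set: T] -> P !=set0 -> total_on P subset ->
  (forall A, P A -> closed A) -> (forall A, P A -> A !=set0) ->
  exists x, forall A, P A -> A x.
Proof.
move=> cT [A0 PA0] totP cP P0.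
have fP : ProperFilter (filter_from P id).
  apply: filter_from_proper => //.
  apply: filter_from_filter; first by exists A0.
  move=> A B PA PB; have [AB|BA] := totP _ _ PA PB.
    by exists A => // x Ax; split=> //; exact: AB.
  by exists B => // x Bx; split=> //; exact: BA.
have [x [_ clx]] := cT _ fP (filterT (F := filter_from P id)).
exists x => A PA; apply: (cP A PA) => V Vx.
by apply: clx => //; exists A.
Qed.

Lemma decreasing_bigcap_nonempty {T : topologicalType} {K : nat -> set T} :
  compact [set: T] -> (forall n, closed (K n)) ->
  (forall n, K n.+1 `<=` K n) -> (forall n, K n !=set0) ->
  exists x, forall n, K n x.
Proof.
move=> cT cK decK K0.
have leK m n : (m <= n)%N -> K n `<=` K m.
  elim: n => [|n IH]; first by rewrite leqn0 => /eqP ->.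
  rewrite leq_eqVlt ltnS => /orP[/eqP ->//|mn].
  exact: subset_trans (decK n) (IH mn).
have [|_ _ [m _ <-] [n _ <-]|_ [n _ <-]//|_ [n _ <-]//|x xK] :=
    @chain_bigcap_nonempty _ (range K) cT.
- by exists (K 0%N); exists 0%N.
- by case: (leqP m n) => [|/ltnW] mn; [right|left]; exact: leK.
by exists x => n; apply: xK; exists n.
Qed.

Lemma closed_neighborhood {T : topologicalType} {A O : set T} :
  hausdorff_space T -> compact [set: T] -> closed A -> open O -> A `<=` O ->
  exists E, [/\ closed E, A `<=` interior E & E `<=` O].
Proof.
move=> hT cT cA oO AO.
have [|E /set_nbhsP[V [oV AV VE]] EO] := @compact_normal _ hT cT A cA O.
  by apply/set_nbhsP; exists O; split.
exists (closure E); split=> [|x /AV Vx|]; [exact: closed_closure| |exact: EO].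
apply: (filterS (subset_trans VE (@subset_closure _ E))).
exact: open_nbhs_nbhs.
Qed.

Lemma closed_preimage {S U : topologicalType} {f : S -> U} {A : set U} :
  continuous f -> closed A -> closed (f @^-1` A).
Proof. by move=> /continuous_closedP; exact. Qed.

Lemma pair_continuous {S T U : topologicalType} {f : S -> T} {g : S -> U} :
  continuous f -> continuous g -> continuous (fun x => (f x, g x)).
Proof. by move=> cf cg x; apply: cvg_pair; [exact: cf|exact: cg]. Qed.

Lemma closed_image {T U : topologicalType} {f : T -> U} {A : set T} :
  compact [set: T] -> hausdorff_space U -> continuous f -> closed A ->
  closed (f @` A).
Proof.
move=> cT hU cf cA; apply: compact_closed => //; apply: continuous_compact.
  exact: continuous_subspaceT.
exact: subclosed_compact cA cT _.
Qed.

Lemma closed_graph_continuous {T U : topologicalType} (f : T -> U) :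
  compact [set: U] -> closed [set tu : T * U | tu.2 = f tu.1] -> continuous f.
Proof.
move=> cU cf; apply/continuous_closedP => A cA.
have -> : f @^-1` A = snd @` [set ut : U * T | A ut.1 /\ ut.1 = f ut.2].
  apply/seteqP; split=> [t At|_ [[u t] /= [Au uE] <-]]; last by rewrite -uE.
  by exists (f t, t).
apply: closed_snd_image => //; apply: closedI.
  by apply: closed_preimage cA => ?; exact: cvg_fst.
exact: (closed_preimage (@swap_continuous U T) cf).
Qed.

Lemma compact_set_type {T : topologicalType} {D : set T} :
  compact D -> compact [set: D].
Proof.
move=> cD G PG _.
have GD : (set_val @ G) D; first rewrite /fmap /=.
  by apply: (@filterS _ G _ setT) => [y _|]; [exact: set_valP|exact: filterT].
have [x [Dx clx]] := cD _ _ GD.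
exists (SigSub (mem_set Dx) : D); split=> // A B GA.
rewrite nbhsE => -[_ [[V oV <-] Vx] VB].
have [||y [[a Aa ay] Vy]] := clx (set_val @` A) V.
- by rewrite /fmap /=; apply: (@filterS _ G _ A) GA => a Aa; exists a.
- exact: open_nbhs_nbhs.
by exists a; split=> //; apply: VB; rewrite /= ay.
Qed.

(** * Closed relations *)

Section relations.
Context {T : topologicalType}.
Implicit Types (F : set (T * T)) (A B O : set T).

Lemma rel_imageP F A y : rel_image F A y <-> exists2 x, A x & F (x, y).
Proof.
by split=> -[x Ax]; [move/xsectionP; exists x|exists x => //; apply/xsectionP].
Qed.

Lemma rel_pow_trans F m n x y z :
  rel_pow F m (x, y) -> rel_pow F n (y, z) -> rel_pow F (m + n) (x, z).
Proof.
move=> xy; elim: n z => [|n IH] z.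
  by rewrite /= /diagonal /= => <-; rewrite addn0.
by rewrite addnS => -[w yw wz]; exists w => //; exact: IH.
Qed.

Lemma rel_pow1 F x y : F (x, y) -> rel_pow F 1 (x, y).
Proof. by exists x. Qed.

Lemma closed_rel_inv F : closed F -> closed (F^-1)%relation.
Proof. exact: closed_preimage swap_continuous. Qed.

Lemma map_rel_image f A : rel_image (map_rel f) A = f @` A.
Proof.
apply/seteqP; split=> [y /rel_imageP[x Ax]|y [x Ax <-]].
  by rewrite /map_rel /= => ->; exists x.
by apply/rel_imageP; exists x.
Qed.

Lemma map_rel_pow (f : T -> T) n : rel_pow (map_rel f) n = map_rel (iter n f).
Proof.
elim: n => [|n IH]; apply/seteqP; split=> -[x y] //=.
- by rewrite IH => -[z]; rewrite /map_rel /= => -> ->.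
- by rewrite IH /map_rel /= => ->; exists (iter n f x).
Qed.

Lemma map_rel_pow_image (f : T -> T) n A :
  rel_image (rel_pow (map_rel f) n) A = iter n f @` A.
Proof. by rewrite map_rel_pow map_rel_image. Qed.

Hypothesis compactT : compact [set: T].

Lemma closed_rel_image F A : closed F -> closed A -> closed (rel_image F A).
Proof.
move=> cF cA.
have -> : rel_image F A = snd @` (F `&` fst @^-1` A).
  apply/seteqP; split=> [y /rel_imageP[x Ax Fxy]|y [[x y'] [Fxy Ax] <-]].
    by exists (x, y).
  by apply/rel_imageP; exists x.
apply: closed_snd_image => //; apply: closedI => //.
by apply: closed_preimage cA => ?; exact: cvg_fst.
Qed.

(** Upper semicontinuity of closed relations. *)
Lemma open_rel_core F O : closed F -> open O ->
  open [set x | forall y, F (x, y) -> O y].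
Proof.
move=> cF oO; rewrite -closedC.
have -> : ~` [set x | forall y, F (x, y) -> O y] =
    rel_image (F^-1)%relation (~` O).
  apply/seteqP; split=> [x /= /existsNP[y /not_implyP[Fxy nOy]]|x].
    by apply/rel_imageP; exists y.
  by move=> /rel_imageP[y nOy Fxy] /(_ y Fxy).
by apply: closed_rel_image; [exact: closed_rel_inv|exact: open_closedC].
Qed.

Lemma closed_rel_comp F (G : set (T * T)) :
  closed F -> closed G -> closed (G \; F)%relation.
Proof.
move=> cF cG.
pose P : set (T * (T * T)) := (fun p => (p.2.1, p.1)) @^-1` F `&`
  (fun p => (p.1, p.2.2)) @^-1` G.
have -> : (G \; F)%relation = snd @` P.
  apply/seteqP; split; last by move=> _ [[y [x z]] [/= Fxy Gyz] <-]; exists y.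
  move=> [x z] /= [y Fxy Gyz].
  by exists (y, (x, z)).
have c1 : continuous (fun p : T * (T * T) => p.1) by move=> ?; exact: cvg_fst.
have c2 : continuous (fun p : T * (T * T) => p.2) by move=> ?; exact: cvg_snd.
apply: closed_snd_image => //; apply: closedI.
  apply: closed_preimage cF => p.
  apply: cvg_pair; last exact: c1.
  by apply: (@continuous_comp _ _ _ snd fst); [exact: c2|exact: cvg_fst].
apply: closed_preimage cG => p.
apply: cvg_pair; first exact: c1.
by apply: (@continuous_comp _ _ _ snd snd); [exact: c2|exact: cvg_snd].
Qed.

End relations.

(** * Inward sets *)

Lemma iter_continuous {T : topologicalType} {f : T -> T} :
  continuous f -> forall n, continuous (iter n f).
Proof.
move=> cf; elim=> [|n IH] x; first exact: cvg_id.
by apply: continuous_comp; [exact: IH|exact: cf].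
Qed.

Section inward.
Context {T : topologicalType} {F : set (T * T)} {W : set T}.
Hypotheses (hT : hausdorff_space T) (cT : compact [set: T]).
Hypotheses (cF : closed F) (oW : open W).

(** The recursion follows the first step of an orbit, so that openness comes
    from [open_rel_core] one step at a time. *)
Fixpoint confined (Q : set T) (n : nat) : set T :=
  if n is n'.+1 then W `&` [set x | forall y, F (x, y) -> confined Q n' y]
  else Q.

Lemma open_confined Q n : open Q -> open (confined Q n).
Proof.
move=> oQ; elim: n => [//|n IH] /=; apply: openI => //.
exact: open_rel_core.
Qed.

Lemma confined_end Q Q' n x : confined Q n x ->
  (forall y, rel_pow F n (x, y) -> Q' y) -> confined Q' n x.
Proof.
elim: n x => [|n IH] x /=; first by move=> _; apply.
move=> [Wx Fx] H; split=> // y Fxy; apply: IH; first exact: Fx.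
move=> z yz; apply: H.
exact: rel_pow_trans (rel_pow1 Fxy) yz.
Qed.

Lemma confined_absorbed Q D n : D `<=` W `&` Q -> rel_image F D `<=` D ->
  D `<=` confined Q n.
Proof.
move=> DWQ FD; elim: n => [|n IH] x Dx /=; first by have [] := DWQ _ Dx.
split=> [|y Fxy]; first by have [] := DWQ _ Dx.
by apply/IH/FD/rel_imageP; exists x.
Qed.

(** Take [E], a closed neighbourhood of [F E], a closed neighbourhood of the
    image of that one, and so on: if each is small enough, the union of the
    first [n + 1] sets stays in [W] and every image but the last is absorbed. *)
Lemma inward_hull Q n E : open Q -> closed E -> E `<=` confined Q n.+1 ->
  exists U, [/\ closed U, E `<=` U, U `<=` W &
    rel_image F U `<=` interior U `|` Q].
Proof.
move=> oQ; elim: n E => [|n IH] E cE EQ.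
  exists E; split => // [x /EQ[]//|y /rel_imageP[x Ex Fxy]].
  by right; have [_] := EQ _ Ex; apply.
have [||E' [cE' FE E'Q]] :=
    closed_neighborhood (O := confined Q n.+1) hT cT
      (closed_rel_image cT cF cE).
- exact: open_confined.
- by move=> y /rel_imageP[x Ex Fxy]; have [_] := EQ _ Ex; apply.
have [U [cU E'U UW FU]] := IH E' cE' E'Q.
exists (E `|` U); split.
- exact: closedU.
- by move=> x; left.
- by move=> x [/EQ[]//|/UW].
move=> y /rel_imageP[x [Ex|Ux] Fxy].
  left; apply: (interiorS (subset_trans E'U (@subsetUr _ E U))).
  by apply: FE; apply/rel_imageP; exists x.
have [|iUy|Qy] := FU y; [by apply/rel_imageP; exists x| |by right].
by left; exact: interiorS (@subsetUr _ E U) _ iUy.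
Qed.

(** An absorbing neighbourhood need not be inward. Here [D] is absorbed in
    itself and attracts [W] in [k + 1] steps, so a closed neighbourhood [E] of
    [D] that stays in [W] for that long is sent into its own interior by
    [rel_pow F k.+1], and the hull of [E] closes up into an inward set. *)
Lemma inward_between D k : closed D -> D `<=` W -> rel_image F D `<=` D ->
  (forall x y, W x -> rel_pow F k.+1 (x, y) -> D y) ->
  exists U, [/\ inward F U, D `<=` interior U & U `<=` W].
Proof.
move=> cD DW FD WD.
have [||E [cE DE EW]] := closed_neighborhood (O := confined W k.+1) hT cT cD.
- exact: open_confined.
- by apply: confined_absorbed => // x Dx; split; exact: DW.
have [x Ex|U [cU EU UW FU]] := inward_hull (n := k) (@open_interior _ E) cE.
  apply: confined_end (EW x Ex) _ => y xy; apply: DE.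
  by apply: WD xy; have [] := EW _ Ex.
exists U; split=> //; last exact: subset_trans DE (interiorS EU).
split=> //; rewrite /well_inside.
rewrite -(closure_id _).1; last exact: closed_rel_image.
by move=> y /FU[//|]; exact: interiorS.
Qed.

End inward.

(** Transfer along a projection [p] of an inward set [G] of a map [S]. With
    [D] the projection of the image of [G] under [k + 1] steps of [S], the three
    hypotheses say that the whole fibre above a point of [D] is in the interior
    of [G], that [D] is forward invariant under [F], and that paths lift.
    The set [W] of points whose fibre is in the interior of [G] is then open,
    since [p] is a closed map, and contains [D]; lifting a path that starts in
    [W] shows that [k + 1] steps bring [W] into [D]. *)
Lemma inward_lift {X Y : topologicalType} {F : set (X * X)} {S : Y -> Y}
    {p : Y -> X} {G : set Y} {k : nat} :
  hausdorff_space X -> compact [set: X] -> closed F ->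
  hausdorff_space Y -> compact [set: Y] -> continuous S -> continuous p ->
  closed G ->
  (forall z w, G z -> p w = p (iter k.+1 S z) -> interior G w) ->
  (forall z y, G z -> F (p (iter k.+1 S z), y) ->
    exists2 z', G z' & p (iter k.+1 S z') = y) ->
  (forall x y, rel_pow F k.+1 (x, y) ->
    exists2 w, p w = x & p (iter k.+1 S w) = y) ->
  exists U, [/\ inward F U,
    well_inside (rel_image (rel_pow (map_rel S) k.+1) G) (p @^-1` U),
    well_inside (p @^-1` U) G &
    p @` (iter k.+1 S @` G) `<=` U].
Proof.
move=> hX cX cF hY cY cS cp cG Hin Hinv Hlift.
pose D := p @` (iter k.+1 S @` G).
pose W := ~` (p @` (~` interior G)).
have cSG : closed (iter k.+1 S @` G).
  exact: closed_image cY hY (@iter_continuous _ _ cS k.+1) cG.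
have oW : open W.
  apply: closed_openC; apply: (closed_image cY hX cp).
  exact/open_closedC/open_interior.
have cD : closed D by exact: closed_image cY hX cp cSG.
have [|||U [iU DU UW]] := @inward_between X F W hX cX cF oW D k cD.
- move=> _ [_ [z Gz <-] <-] [w nGw pw]; apply: nGw; exact: Hin pw.
- move=> y /rel_imageP[_ [_ [z Gz <-] <-] Fy].
  have [z' Gz' <-] := Hinv z y Gz Fy.
  by exists (iter k.+1 S z') => //; exists z'.
- move=> x y Wx /Hlift[w wx <-]; exists (iter k.+1 S w) => //.
  exists w => //; apply: contrapT => nGw.
  by apply: Wx; exists w => // /interior_subset.
have cU : closed (p @^-1` U) by apply: closed_preimage => //; case: iU.
exists U; split => //.
- rewrite map_rel_pow_image /well_inside -(closure_id _).1 // => _ [z Gz <-].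
  rewrite /interior /=; apply: cp.
  by apply: DU; exists (iter k.+1 S z) => //; exists z.
- rewrite /well_inside -(closure_id _).1 // => w Uw; apply: contrapT => nGw.
  by apply: (UW _ Uw); exists w.
- by move=> x Dx; apply: interior_subset; exact: DU.
Qed.

(** * Distances *)

Section distances.
Context {R : realType} {T : topologicalType} {d : T -> T -> R}.
Hypothesis dP : compatible_metric d.

Lemma nbhs_dist (x : T) (e : R) : 0 < e -> nbhs x [set y | d x y < e].
Proof. by move=> e0; case: dP => _ _ _ /(_ x _)->; exists e. Qed.

Lemma open_dist_ball (x : T) (e : R) : open [set y | d x y < e].
Proof.
case: (dP) => _ _ dT _; rewrite openE => y /= xye.
have r0 : 0 < e - d x y by rewrite subr_gt0.
apply: filterS (nbhs_dist y r0) => z /= yz.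
by have := dT x y z; move: yz; lra.
Qed.

Lemma open_dist_rel (e : R) : open (dist_rel d e).
Proof.
case: (dP) => _ dC dT _; rewrite openE => -[x y] /= xye; rewrite /interior.
have r0 : 0 < (e - d x y) / 2 by rewrite divr_gt0// subr_gt0.
exists ([set u | d x u < (e - d x y) / 2], [set v | d y v < (e - d x y) / 2]).
  by split; exact: nbhs_dist.
move=> [u v] /= [xu yv]; rewrite /dist_rel /=.
have := dT u x v; have := dT x y v; rewrite (dC u x); move: xu yv; lra.
Qed.

Lemma closed_dist_le (e : R) : closed [set xy : T * T | d xy.1 xy.2 <= e].
Proof.
case: (dP) => _ dC dT _; rewrite -openC openE => -[x y] /= /negP.
rewrite -ltNge => exy; rewrite /interior.
have r0 : 0 < (d x y - e) / 2 by rewrite divr_gt0// subr_gt0.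
exists ([set u | d x u < (d x y - e) / 2], [set v | d y v < (d x y - e) / 2]).
  by split; exact: nbhs_dist.
move=> [u v] /= [xu yv]; apply/negP; rewrite -ltNge.
have := dT x u y; have := dT u v y; rewrite (dC v y); move: xu yv; lra.
Qed.

End distances.

Lemma closed_equalizer {R : realType} {X : metricType R} {T : topologicalType}
    (f g : T -> X) : continuous f -> continuous g -> closed [set t | f t = g t].
Proof.
move=> cf cg.
have -> : [set t | f t = g t] =
    (fun t => (f t, g t)) @^-1` [set xy : X * X | mdist xy.1 xy.2 <= 0].
  apply/seteqP; split=> t /= => [->|fg]; first by rewrite mdistxx.
  by apply: mdist_positivity; apply/eqP; rewrite eq_le fg mdist_ge0.
apply: (closed_preimage (pair_continuous cf cg)).
exact: (@closed_dist_le _ _ _ (mdist_compatible X) 0).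
Qed.

Lemma le_invn_eq0 {R : realType} (r : R) (m : nat) :
  0 <= r -> (forall n, (m <= n)%N -> r <= n.+1%:R^-1) -> r = 0.
Proof.
move=> r0 rle; apply/eqP; rewrite eq_le r0 andbT leNgt; apply/negP => rgt0.
have [n] := ltr_add_invr rgt0; rewrite add0r => nr.
have := lt_le_trans nr (rle _ (leq_maxl m n)).
by rewrite ltf_pV2 ?posrE ?ltr0n// ltr_nat ltnS ltnNge leq_maxr.
Qed.

(** * Orbit spaces *)

Section orbit_spaces.
Context {R : realType} {X : metricType R} {I : eqType}.
Variable s : I -> I.

(** One-sided orbits are the case of the successor on [nat], two-sided ones
    that of the successor on [int]. *)
Definition orbits (F : set (X * X)) : set {ptws I -> X} :=
  [set x | forall i, F (x i, x (s i))].

Definition coord {F : set (X * X)} (x : orbits F) : I -> X :=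
  set_val x : {ptws I -> X}.

Definition is_shift {F : set (X * X)} (S : orbits F -> orbits F) :=
  forall x i, coord (S x) i = coord x (s i).

Lemma eval_continuous i : continuous (fun x : {ptws I -> X} => x i).
Proof. exact: (@proj_continuous I (fun=> X) i). Qed.

Lemma closed_orbits (F : set (X * X)) : closed F -> closed (orbits F).
Proof.
move=> cF.
have -> : orbits F =
    \bigcap_i ((fun x : {ptws I -> X} => (x i, x (s i))) @^-1` F).
  by apply/seteqP; split=> [x Fx i _|x Fx i]; [exact: Fx|exact: (Fx i)].
apply: closed_bigI => i _; exact: (closed_preimage
  (pair_continuous (@eval_continuous i) (@eval_continuous (s i))) cF).
Qed.

Context {F : set (X * X)}.
Implicit Types (x y z w : orbits F).

Lemma coordP x i : F (coord x i, coord x (s i)).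
Proof. exact: (set_valP x i). Qed.

Lemma coord_orbit (a : I -> X) : (forall i, F (a i, a (s i))) ->
  exists x, coord x = a.
Proof. by move=> Fa; exists (SigSub (mem_set (Fa : orbits F a))). Qed.

Lemma coord_inj x y : coord x =1 coord y -> x = y.
Proof. by move=> xy; apply: val_inj; apply/funext. Qed.

Lemma coord_continuous i : continuous (fun x => coord x i).
Proof.
move=> x; apply: (@continuous_comp _ _ _ (set_val : orbits F -> {ptws I -> X})
  (fun z : {ptws I -> X} => z i)).
  exact: (@initial_continuous (orbits F) {ptws I -> X} set_val).
exact: eval_continuous.
Qed.

Lemma hausdorff_orbits : hausdorff_space (orbits F).
Proof.
move=> x y xy; apply: coord_inj => i; apply: metric_hausdorff => A B xA yB.
have [z []] := xy _ _ (@coord_continuous i x _ xA) (@coord_continuous i y _ yB).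
by exists (coord z i).
Qed.

Lemma closed_shift (S : orbits F -> orbits F) :
  is_shift S -> closed (map_rel S).
Proof.
move=> Ss.
have -> : map_rel S = \bigcap_i [set xy | coord xy.2 i = coord xy.1 (s i)].
  apply/seteqP; split=> [[x y]|[x y] /= xy].
    by rewrite /map_rel /= => -> i _ /=; rewrite Ss.
  by apply: coord_inj => i; rewrite Ss; exact: xy.
apply: closed_bigI => i _; apply: closed_equalizer => xy.
  by apply: (@continuous_comp _ _ _ snd (fun x => coord x i));
    [exact: cvg_snd|exact: coord_continuous].
by apply: (@continuous_comp _ _ _ fst (fun x => coord x (s i)));
  [exact: cvg_fst|exact: coord_continuous].
Qed.

Lemma coord_iter_shift (S : orbits F -> orbits F) : is_shift S ->
  forall n x i, coord (iter n S x) i = coord x (iter n s i).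
Proof.
by move=> Ss; elim=> [//|n IH] x i; rewrite iterSr IH Ss iterS.
Qed.

Hypotheses (compactX : compact [set: X]) (closedF : closed F).

Lemma compact_orbits : compact [set: orbits F].
Proof.
apply: compact_set_type.
apply: (@subclosed_compact _ _ setT) => //; first exact: closed_orbits.
have := @tychonoff I (fun=> X) (fun=> setT) (fun=> compactX).
by congr (compact _); apply/seteqP; split.
Qed.

(** A map into a compact space is continuous as soon as its graph is closed. *)
Lemma shift_continuous (S : orbits F -> orbits F) : is_shift S -> continuous S.
Proof.
move=> Ss; apply: closed_graph_continuous; first exact: compact_orbits.
exact: closed_shift.
Qed.

Variable sz : I -> nat.

(** Windows, the finite-coordinate neighbourhoods of the product topology: [sz]
    measures how far an index is from the origin, and a single [n] controls both
    the length of the window and the precision on it. *)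
Definition window_close (n : nat) (x y : I -> X) :=
  forall i, (sz i <= n)%N -> mdist (x i) (y i) <= n.+1%:R^-1.

(** The pairs in [C] that are close on the window [n] form a decreasing sequence
    of compact sets, and a common point would be on the diagonal. *)
Lemma window_separates (C : set (orbits F * orbits F)) : closed C ->
  (forall x, ~ C (x, x)) ->
  exists n, forall x y, C (x, y) -> ~ window_close n (coord x) (coord y).
Proof.
move=> cC nC; apply: contrapT => /forallNP H.
pose K n := C `&` [set xy | window_close n (coord xy.1) (coord xy.2)].
have [|n|n [x y] /= [Cxy xyn]|n|[x y] xyK] :=
    @decreasing_bigcap_nonempty _ K.
- have := compact_setX compact_orbits compact_orbits.
  by congr (compact _); apply/seteqP; split.
- apply: closedI => //.
  have -> : [set xy | window_close n (coord xy.1) (coord xy.2)] =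
      \bigcap_(i in [set i | (sz i <= n)%N])
        (fun xy : orbits F * orbits F => (coord xy.1 i, coord xy.2 i)) @^-1`
          [set uv : X * X | mdist uv.1 uv.2 <= n.+1%:R^-1] by [].
  apply: closed_bigI => i _.
  apply: (fun c =>
    closed_preimage c (@closed_dist_le _ _ _ (mdist_compatible X) _)).
  apply: pair_continuous => xy.
    by apply: (@continuous_comp _ _ _ fst (fun x => coord x i));
      [exact: cvg_fst|exact: coord_continuous].
  by apply: (@continuous_comp _ _ _ snd (fun x => coord x i));
    [exact: cvg_snd|exact: coord_continuous].
- split=> // i ni; apply: le_trans (xyn i (leqW ni)) _.
  by rewrite lef_pV2 ?posrE ?ltr0n// ler_nat.
- have /existsNP[x /existsNP[y /not_implyP[Cxy /contrapT xyn]]] := H n.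
  by exists (x, y).
have [Cxy _] := xyK 0%N.
suff xy : x = y by apply: (nC x); rewrite {2}xy.
apply: coord_inj => i; apply: mdist_positivity.
apply: (@le_invn_eq0 _ _ (sz i)); first exact: mdist_ge0.
by move=> n ni; have [_] := xyK n; apply.
Qed.

End orbit_spaces.

(** * Splicing orbits *)

Section splicing.
Context {T : Type} {F : set (T * T)}.

Definition splice (a : nat) (f g : nat -> T) (n : nat) : T :=
  if (n <= a)%N then f n else g (n - a)%N.

Lemma splice_left a f g n : (n <= a)%N -> splice a f g n = f n.
Proof. by rewrite /splice => ->. Qed.

Lemma splice_right a f g n : f a = g 0%N -> splice a f g (a + n)%N = g n.
Proof.
rewrite /splice => fg; case: n => [|n]; first by rewrite addn0 leqnn.
by rewrite ifN ?addKn// -ltnNge -addSnnS leq_addr.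
Qed.

Lemma splice_orbit a f g : f a = g 0%N ->
  (forall n, (n < a)%N -> F (f n, f n.+1)) -> (forall n, F (g n, g n.+1)) ->
  forall n, F (splice a f g n, splice a f g n.+1).
Proof.
move=> fg Ff Fg n; case: (ltnP n a) => [na|an].
  by rewrite !splice_left// ?(ltnW na)//; exact: Ff.
by rewrite -(subnKC an) -addnS !splice_right.
Qed.

Definition bi_splice (a : int) (z : int -> T) (g : nat -> T) (i : int) : T :=
  if i <= a then z i else g `|i - a|%N.

Lemma bi_splice_left a z g i : i <= a -> bi_splice a z g i = z i.
Proof. by rewrite /bi_splice => ->. Qed.

Lemma bi_splice_right a z g (n : nat) : z a = g 0%N ->
  bi_splice a z g (a + n%:Z) = g n.
Proof.
rewrite /bi_splice => zg; case: n => [|n]; first by rewrite addr0 lexx.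
by rewrite ifF; [congr g|]; lia.
Qed.

Lemma bi_splice_orbit a z g : z a = g 0%N ->
  (forall i, i < a -> F (z i, z (i + 1))) -> (forall n, F (g n, g n.+1)) ->
  forall i, F (bi_splice a z g i, bi_splice a z g (i + 1)).
Proof.
move=> zg Fz Fg i; case: (ltP i a) => ia.
  rewrite !bi_splice_left; [exact: Fz|lia|lia].
have [n ->] : exists n : nat, i = a + n%:Z by exists `|i - a|%N; lia.
by rewrite -addrA -PoszD addn1 !bi_splice_right.
Qed.

Hypotheses (succF : forall x, exists y, F (x, y)).

Lemma fwd_extend x :
  exists2 f : nat -> T, f 0%N = x & forall n, F (f n, f n.+1).
Proof.
have [f [f0 Ff]] := dependent_choice (fun y => cid (succF y)) x.
by exists f.
Qed.

Lemma path_extend k x y : rel_pow F k (x, y) ->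
  exists f : nat -> T, [/\ f 0%N = x, f k = y & forall n, F (f n, f n.+1)].
Proof.
elim: k y => [|k IH] y.
  by rewrite /= /diagonal /= => <-; have [f f0 Ff] := fwd_extend x; exists f.
move=> [z /IH[f [f0 fk Ff]] /= zy]; have [g g0 Fg] := fwd_extend y.
pose h n := if n is n'.+1 then g n' else z.
have fh : f k = h 0%N by [].
exists (splice k f h); split; first by rewrite splice_left.
  by rewrite -addn1 splice_right.
by apply: splice_orbit => [//|n _|[|n]]; [exact: Ff|rewrite /= g0|exact: Fg].
Qed.

Lemma bi_extend (predF : forall x, exists y, F (y, x)) (a : int) x :
  exists2 z : int -> T, z a = x & forall i, F (z i, z (i + 1)).
Proof.
have [f f0 Ff] := fwd_extend x.
have [b [b0 Fb]] := dependent_choice (fun y => cid (predF y)) x.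
pose z i := b `|a - i|%N.
have za : z a = f 0%N by rewrite /z subrr b0.
exists (bi_splice a z f); first by rewrite bi_splice_left// za.
apply: bi_splice_orbit => // i ia.
have -> : z i = b `|a - (i + 1)%R|%N.+1 by congr b; lia.
exact: Fb.
Qed.

End splicing.

Lemma rel_surjectiveP {T : Type} {F : set (T * T)} : rel_surjective F ->
  (forall x, exists y, F (x, y)) /\ (forall x, exists y, F (y, x)).
Proof.
move=> [FT FVT]; split=> x.
  have : rel_image (F^-1)%relation [set: T] x by rewrite FVT.
  by move=> [y _ /xsectionP]; exists y.
have : rel_image F [set: T] x by rewrite FT.
by move=> [y _ /xsectionP]; exists y.
Qed.

Lemma iter_succz n (i : int) : iter n (fun i => i + 1) i = i + n%:Z.
Proof. by elim: n => [|n IH] /=; [rewrite addr0|rewrite IH; lia]. Qed.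

(** * Attractors of the shifts *)

Section shift_inward.
Context {R : realType} {X : metricType R} {F : set (X * X)} {I : eqType}.
Context {s : I -> I} {S : orbits s F -> orbits s F} {G : set (orbits s F)}.
Hypotheses (compactX : compact [set: X]) (closedF : closed F).
Hypotheses (Ss : is_shift S) (inG : inward (map_rel S) G).

Lemma orbit_rel_pow (x : orbits s F) n i :
  rel_pow F n (coord x i, coord x (iter n s i)).
Proof.
by elim: n => [//|n IH]; exists (coord x (iter n s i)) => //; exact: coordP.
Qed.

Lemma inward_step z : G z -> interior G (S z).
Proof.
case: inG => _ + Gz; apply; apply: subset_closure.
by apply/rel_imageP; exists z.
Qed.

Lemma inward_iter n z : G z -> G (iter n S z).
Proof. by elim: n => [//|n IH] /IH /inward_step /interior_subset. Qed.

(** Whether an orbit is in [G] can be read off a finite window if it agrees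
    there with an orbit that has just been shifted from [G]. *)
Lemma inward_window (sz : I -> nat) : exists n, forall z w, G z ->
  (forall i, (sz i <= n)%N -> coord w i = coord (S z) i) -> interior G w.
Proof.
pose C := (S @` G) `*` (~` interior G).
have [||n nC] := @window_separates _ _ _ s F compactX closedF sz C.
- have cS := shift_continuous compactX closedF Ss.
  have cSG : closed (S @` G).
    have hY : hausdorff_space (orbits s F) by exact: hausdorff_orbits.
    have [cG _] := inG.
    exact: closed_image (compact_orbits (s := s) compactX closedF) hY cS cG.
  have cG : closed (~` interior G) by exact/open_closedC/open_interior.
  apply: closedI.
    by apply: closed_preimage cSG => ?; exact: cvg_fst.
  by apply: closed_preimage cG => ?; exact: cvg_snd.
- by move=> x [[z Gz /= zx] /=]; rewrite -zx; apply; exact: inward_step.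
exists n => z w Gz zw; apply: contrapT => nGw.
have [] := nC (S z) w; first by split=> //; exists z.
by move=> i ni; rewrite zw// mdistxx invr_ge0.
Qed.

End shift_inward.

Section fwd_attractor.
Context {R : realType} {X : metricType R} {F : set (X * X)}.
Hypotheses (compactX : compact [set: X]) (closedF : closed F).
Hypothesis (surjF : rel_surjective F).

Let S := fwd_shift F : orbits succn F -> orbits succn F.

Let Ss : is_shift S. Proof. by []. Qed.

Let coordS n (x : orbits succn F) i : coord (iter n S x) i = coord x (i + n)%N.
Proof. by rewrite (coord_iter_shift Ss) iter_succn. Qed.

(** If [z] is in [G] and [w] starts where [z] is at time [K + 2], replace the
    tail of the shift of [z] from time [K + 1] on by [w]: the spliced orbit
    agrees with the shift of [z] on the window [K], hence is in [G], and its
    shifts reach [w]. So membership in a high iterate of [G] depends on the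
    current point only. *)
Lemma fwd_inward (G : set (fwd_orbits F)) : inward (map_rel (fwd_shift F)) G ->
  exists (U : set X) (N : nat),
    [/\ inward F U,
        (0 < N)%N,
        well_inside (rel_image (rel_pow (map_rel (fwd_shift F)) N) G)
          (fwd_proj F 0%N @^-1` U),
        well_inside (fwd_proj F 0%N @^-1` U) G &
        fwd_proj F 0%N @^-1` attractor F U =
          attractor (map_rel (fwd_shift F)) G].
Proof.
move=> inG; have [succF _] := rel_surjectiveP surjF.
have [K GK] := @inward_window _ X F nat succn S G compactX closedF Ss inG id.
have splice_in (z : orbits succn F) (g : nat -> X) :
    G z -> (forall n, F (g n, g n.+1)) -> g 0%N = coord z K.+2 ->
    exists2 v : orbits succn F, G v & forall n, coord v (K.+1 + n)%N = g n.
  move=> Gz Fg g0; pose f n := coord z n.+1.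
  have fg : f K.+1 = g 0%N by rewrite g0.
  have [v vE] := coord_orbit (splice_orbit fg (fun n _ => coordP z n.+1) Fg).
  exists v => [|n]; last by rewrite vE splice_right.
  apply: interior_subset; apply: (GK z) => // i iK.
  by rewrite vE splice_left ?(leqW iK)// Ss.
have hX : hausdorff_space X by exact: metric_hausdorff.
have hY : hausdorff_space (orbits succn F) by exact: hausdorff_orbits.
have cY := compact_orbits (s := succn) compactX closedF.
have cS := shift_continuous compactX closedF Ss.
have [cG _] := inG.
have [z w Gz|z y Gz|x y xy|U [inU SGU UG pU]] := @inward_lift _ _ F S _ G K.+1
    hX compactX closedF hY cY cS (@coord_continuous _ _ _ succn F 0%N) cG.
- rewrite coordS => wz.
  have [v Gv vw] := splice_in z (coord w) Gz (coordP w) wz.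
  have -> : w = S (iter K S v).
    by apply: coord_inj => i; rewrite -iterS coordS addnC vw.
  exact/(inward_step inG)/(inward_iter inG).
- rewrite coordS add0n => /rel_pow1 /(path_extend succF)[g [g0 g1 Fg]].
  have [v Gv vg] := splice_in z g Gz Fg g0.
  by exists v => //; rewrite coordS -[K.+2]addn1 add0n vg.
- have [f [f0 fN Ff]] := path_extend succF xy.
  have [w wE] := @coord_orbit _ _ _ succn F f Ff.
  by exists w; rewrite ?coordS wE.
exists U, K.+2; split => //.
apply/seteqP; split=> y Ay j /= j0.
  rewrite map_rel_pow_image.
  have /rel_imageP[x Ux xy] := Ay j j0.
  have [f [f0 fj Ff]] := path_extend succF xy.
  have Fy := coordP (y : orbits succn F).
  have [w wE] := coord_orbit (splice_orbit fj (fun n _ => Ff n) Fy).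
  exists w; last by apply: coord_inj => i; rewrite coordS wE addnC splice_right.
  apply: interior_subset; apply: UG; apply: subset_closure.
  have : U (coord w 0%N) by rewrite wE splice_left// f0.
  exact.
have := Ay (K.+2 + j)%N; rewrite map_rel_pow_image => -[|z Gz <-].
  by rewrite /= addnC ltn_addr.
apply/rel_imageP; exists (coord z K.+2).
  by apply: pU; exists (iter K.+2 S z); [exists z|rewrite coordS].
have : rel_pow F j (coord z K.+2, coord (iter (K.+2 + j) S z) 0%N).
  by rewrite coordS add0n -iter_succn; exact: orbit_rel_pow.
exact.
Qed.

End fwd_attractor.

Section bi_attractor.
Context {R : realType} {X : metricType R} {F : set (X * X)}.
Hypotheses (compactX : compact [set: X]) (closedF : closed F).
Hypothesis (surjF : rel_surjective F).

Let succz (i : int) := i + 1.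

Let S := bi_shift F : orbits succz F -> orbits succz F.

Let Ss : is_shift S. Proof. by []. Qed.

Let coordS n (x : orbits succz F) i : coord (iter n S x) i = coord x (i + n%:Z).
Proof. by rewrite (coord_iter_shift Ss) iter_succz. Qed.

(** The splicing is that of the one-sided case, but [w] and the spliced orbit
    agree on the future of the time [- m] only. The window [K] that decides
    membership in [G] must lie in that future, hence [m = K + 1]; the point
    at which [z] is left, at time [K + 2] for [z], is at time [- m] after
    [N = K + m + 2] shifts. *)
Lemma bi_inward (G : set (bi_orbits F)) : inward (map_rel (bi_shift F)) G ->
  exists (U : set X) (N m : nat),
    [/\ inward F U,
        (0 < N)%N /\ (0 < m)%N,
        well_inside (rel_image (rel_pow (map_rel (bi_shift F)) N) G)
          (bi_proj F (- m%:Z) @^-1` U),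
        well_inside (bi_proj F (- m%:Z) @^-1` U) G &
        attractor (map_rel (bi_shift F)) G =
          set_val @^-1` bi_orbits (rel_restr F (attractor F U))].
Proof.
move=> inG; have [succF predF] := rel_surjectiveP surjF.
have [K GK] := @inward_window _ X F int succz S G compactX closedF Ss inG absz.
have splice_in (z : orbits succz F) (g : nat -> X) :
    G z -> (forall n, F (g n, g n.+1)) -> coord z K.+2 = g 0%N ->
    exists2 v : orbits succz F, G v & forall n, coord v (K.+1 + n)%N = g n.
  move=> Gz Fg g0; pose f i := coord z (i + 1).
  have fg : f K.+1 = g 0%N by rewrite -g0 /f -PoszD addn1.
  have Ff i : i < K.+1%:Z -> F (f i, f (i + 1)) by move=> _; exact: coordP.
  have [v vE] := @coord_orbit _ _ _ succz F _ (bi_splice_orbit fg Ff Fg).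
  exists v => [|n]; last by rewrite vE PoszD bi_splice_right.
  apply: interior_subset; apply: (GK z) => // i iK.
  by rewrite vE bi_splice_left ?Ss//; lia.
pose m := K.+1; pose N := (K + m).+2.
have hX : hausdorff_space X by exact: metric_hausdorff.
have hY : hausdorff_space (orbits succz F) by exact: hausdorff_orbits.
have cY := compact_orbits (s := succz) compactX closedF.
have cS := shift_continuous compactX closedF Ss.
have [cG _] := inG.
have SNm x : coord (iter N S x) (- m%:Z) = coord x K.+2.
  by rewrite coordS; congr (coord x _); rewrite /N; lia.
have [z w Gz|z y Gz|x y xy|U [inU SGU UG pU]] :=
    @inward_lift _ _ F S _ G (K + m).+1 hX compactX closedF hY cY cS
    (@coord_continuous _ _ _ succz F (- m%:Z)) cG.
- rewrite SNm => wz; pose g n := coord w (- m%:Z + n%:Z).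
  have [n||v Gv vw] := splice_in z g Gz; first 2 last.
  + apply: (GK (iter (K + m) S v)) => [|i iK]; first exact: (inward_iter inG).
    rewrite -iterS coordS.
    have -> : i + (K + m).+1%:Z = (K.+1 + `|(i + m%:Z)%R|)%N by rewrite /m; lia.
    by rewrite vw /g; congr (coord w _); rewrite /m; lia.
  + by have := coordP w (- m%:Z + n%:Z); rewrite /succz -addrA -PoszD addn1.
  + by rewrite /g addr0 wz.
- rewrite SNm => /rel_pow1 /(path_extend succF)[g [g0 g1 Fg]].
  have [v Gv vg] := splice_in z g Gz Fg (esym g0).
  by exists v => //; rewrite SNm -[K.+2]addn1 vg.
- have [f [f0 fN Ff]] := path_extend succF xy.
  have [z zm Fz] := bi_extend succF predF (- m%:Z) x.
  have zf : z (- m%:Z) = f 0%N by rewrite zm f0.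
  have [w wE] := @coord_orbit _ _ _ succz F _
    (bi_splice_orbit zf (fun i _ => Fz i) Ff).
  exists w; first by rewrite wE bi_splice_left.
  by rewrite coordS wE bi_splice_right.
have GpU (w : orbits succz F) : U (coord w (- m%:Z)) -> G w.
  by move=> Uw; apply: interior_subset; apply: UG; apply: subset_closure.
have FUU : rel_image F U `<=` U.
  case: inU => _ FU y Fy; apply: interior_subset; apply: FU.
  exact: subset_closure.
exists U, N, m; split => //; apply/seteqP; split=> y Ay.
  suff AU i : attractor F U (coord (y : orbits succz F) i).
    move=> i; split; first exact: (coordP (y : orbits succz F) i).
    by split; exact: AU.
  (* [y] is the shift by N + j + m + |i| of some [z] in [G]; this exponent is so
     large that the coordinate i - j of [y] is the coordinate - m of an iterate
     of [z] of order at least N, hence is in [U]. *)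
  move=> j /= j0; have := Ay (N + j + m + `|i|)%N; rewrite map_rel_pow_image.
  move=> -[|z Gz <-]; first by rewrite /= /N; lia.
  apply/rel_imageP; pose q := (`|(i + `|i|%N%:Z)%R| + m + m)%N.
  exists (coord z (q%:Z + K.+2%:Z)).
    apply: pU; exists (iter N S (iter q S z)); last first.
      by rewrite SNm coordS addrC.
    by exists (iter q S z) => //; exact: (inward_iter inG).
  have := orbit_rel_pow (z : orbits succz F) j (q%:Z + K.+2%:Z).
  rewrite iter_succz.
  suff -> : coord (iter (N + j + m + `|i|) (bi_shift F) z : orbits succz F) i =
    coord z (q%:Z + K.+2%:Z + j%:Z) by [].
  by rewrite coordS; congr (coord z _); rewrite /q /N /m; lia.
move=> t /= t0; rewrite map_rel_pow_image.
have Fz i : F (coord (y : orbits succz F) (i - t%:Z),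
    coord (y : orbits succz F) (succz i - t%:Z)).
  by have := coordP (y : orbits succz F) (i - t%:Z); rewrite /succz addrAC.
have [z zE] := @coord_orbit _ _ _ succz F (fun i => coord y (i - t%:Z)) Fz.
exists z; last by apply: coord_inj => i; rewrite coordS zE addrK.
apply: GpU; rewrite zE; apply: FUU.
have [_ [/= Ay1 _]] := Ay (- m%:Z - t%:Z).
have /rel_imageP[u Uu [u' uu' Fu]] := Ay1 1%N isT.
by apply/rel_imageP; exists u => //; rewrite (uu' : u = u').
Qed.

End bi_attractor.

(** * Chains of orbits *)

Section shadowing.
Context {R : realType} {X : metricType R} {F : set (X * X)} {I : eqType}.
Hypotheses (compactX : compact [set: X]) (closedF : closed F).
Variables (s : I -> I) (sz : I -> nat).
Hypothesis finite_window :
  forall n, exists r : seq I, forall i, (sz i <= n)%N -> i \in r.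

Definition jump (e : R) : set (X * X) :=
  (dist_rel (@mdist R X) e \; F)%relation.

Lemma nbhs_window (a : {ptws I -> X}) n :
  nbhs a [set b | window_close sz n a b].
Proof.
have [r rP] := finite_window n.
suff : nbhs a [set b : {ptws I -> X} |
    forall i, i \in r -> mdist (a i) (b i) <= n.+1%:R^-1].
  by apply: filterS => b ab i /rP; exact: ab.
elim: r {rP} => [|j r IH]; first by apply: filterE => b i.
have jn : nbhs a [set b : {ptws I -> X} | mdist (a j) (b j) < n.+1%:R^-1].
  apply: (@eval_continuous _ X I j a [set y | mdist (a j) y < n.+1%:R^-1]).
  by apply: (nbhs_dist (mdist_compatible X)); rewrite invr_gt0 ltr0n.
apply: filterS2 IH jn => b IHb jn i.
rewrite inE => /orP[/eqP->|]; last exact: IHb.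
exact: ltW.
Qed.

Lemma closed_jump_limit x y :
  (forall n : nat, exists2 z, F (x, z) & mdist z y <= n.+1%:R^-1) -> F (x, y).
Proof.
move=> Fz; apply: contrapT => nFxy.
have [[A B] /= [xA yB] AB] : nbhs (x, y) (~` F).
  by apply: open_nbhs_nbhs; split=> //; exact: closed_openC.
have [_ _ _ /(_ y B)[/(_ yB)[e e0 eB] _]] := mdist_compatible X.
have [n] := ltr_add_invr e0; rewrite add0r => ne.
have [z Fxz zy] := Fz n; apply: (AB (x, z)) => //; split=> /=.
  exact: nbhs_singleton.
by apply: eB; rewrite /= metric_sym (le_lt_trans zy).
Qed.

(** Any limit of orbits of [jump e] as [e] tends to [0] is an orbit of [F], so
    by compactness the orbits of [jump e] are near those of [F] on a window. *)
Lemma shadowing n : exists2 e : R, 0 < e &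
  forall a, orbits s (jump e) a ->
    exists z : orbits s F, window_close sz n (coord z) a.
Proof.
apply: contrapT => /forall2NP H.
pose Q m : set {ptws I -> X} := [set a | orbits s (jump m.+1%:R^-1) a /\
  forall z : orbits s F, ~ window_close sz n (coord z) a].
have [|m|m|m|a Qa] := @decreasing_bigcap_nonempty _ (fun m => closure (Q m)).
- have := @tychonoff I (fun=> X) (fun=> setT) (fun=> compactX).
  by congr (compact _); apply/seteqP; split.
- exact: closed_closure.
- apply: closureS => a [ja nz]; split=> // i.
  have [z Fz zi] := ja i; exists z => //; apply: lt_le_trans zi _.
  by rewrite lef_pV2 ?posrE ?ltr0n// ler_nat.
- have [/negP|/existsNP[a /not_implyP[ja /forallNP nz]]] := H m.+1%:R^-1.
    by rewrite invr_gt0 ltr0n.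
  by exists a; apply: subset_closure.
have Fa : orbits s F a.
  move=> i; apply: closed_jump_limit => m.
  pose c : R := m.+1%:R^-1.
  pose J := ([set yz : X * X | mdist yz.1 yz.2 <= c] \; F)%relation.
  have cJ : closed (orbits s J).
    apply: closed_orbits; apply: closed_rel_comp => //.
    exact: (@closed_dist_le _ _ _ (mdist_compatible X)).
  have : closure (orbits s J) a.
    apply: closureS (Qa m) => b [jb _] j.
    by have [z Fz zj] := jb j; exists z => //; exact: ltW.
  by rewrite -(closure_id _).1// => /(_ i)[z Fz zi]; exists z.
have [z za] := coord_orbit Fa.
have [b [[_ nz] ab]] := Qa 0%N _ (nbhs_window a n).
by apply: (nz z); rewrite za.
Qed.

Hypothesis size_succ : forall i, (sz (s i) <= (sz i).+1)%N.
Context {S : orbits s F -> orbits s F} {d : orbits s F -> orbits s F -> R}.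
Hypotheses (Ss : is_shift S) (dP : compatible_metric d).

Lemma window_close_dist (eps : R) : 0 < eps ->
  exists n, forall x y : orbits s F,
    window_close sz n (coord x) (coord y) -> d x y < eps.
Proof.
move=> eps0; have [|x|n nC] := @window_separates _ _ _ s F compactX closedF sz
    (~` dist_rel d eps).
- exact/open_closedC/(open_dist_rel dP).
- have [d0 _ _ _] := dP; move=> /=; apply.
  by rewrite /dist_rel /= (d0 x x).2.
by exists n => x y xy; apply: contrapT => /nC; exact.
Qed.

(** Each shift of a pseudo-orbit [a] is shadowed by an orbit, and the successive
    shadows form a chain for the shift. *)
Lemma pseudo_orbit_chain (eps : R) : 0 < eps ->
  exists n, exists2 e : R, 0 < e &
    forall (a : I -> X) (x y : orbits s F) N, (0 < N)%N ->
      (forall i, jump e (a i, a (s i))) ->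
      (forall i, (sz i <= n)%N -> a i = coord x i) ->
      (forall i, (sz i <= n)%N -> a (iter N s i) = coord y i) ->
      rel_orbit (dist_rel d eps \; map_rel S)%relation (x, y).
Proof.
move=> eps0; have [n0 n0P] := window_close_dist eps0.
(* Shadows at precision 1 / (2 n0 + 2) of consecutive shifts are within
   1 / (n0 + 1) of each other. *)
pose n := (n0.+1 + n0)%N; have [e e0 shad] := shadowing n.
exists n; exists e => // a x y N N0 ja ax ay.
pose good j (z : orbits s F) :=
  window_close sz n (coord z) (fun i => a (iter j s i)).
have good_ex j : exists z, good j z.
  by apply: shad => i; rewrite -iterSr iterS; exact: ja.
have good_step j z w : good j z -> good j.+1 w -> d (S z) w < eps.
  move=> zj wj; apply: n0P => i ni; rewrite Ss.
  have ni1 : (sz (s i) <= n)%N.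
    apply: leq_trans (size_succ i) _.
    by rewrite /n addSn ltnS (leq_trans ni)// leq_addr.
  have ni0 : (sz i <= n)%N by rewrite (leq_trans ni)// leq_addl.
  have zi := zj _ ni1; rewrite -iterSr in zi.
  have wi := wj _ ni0; rewrite metric_sym in wi.
  apply: (le_trans (metric_triangle _ (a (iter j.+1 s i)) _)).
  apply: (le_trans (lerD zi wi)).
  have -> : n.+1%:R = 2 * n0.+1%:R :> R.
    by rewrite -natrM; congr (_%:R); rewrite /n; lia.
  by rewrite invfM; move: (n0.+1%:R^-1 : R) => t; lra.
have gx : good 0%N x by move=> i ni; rewrite /= ax// mdistxx invr_ge0.
have gy : good N y by move=> i ni; rewrite ay// mdistxx invr_ge0.
have chain j z : good j.+1 z ->
    rel_pow (dist_rel d eps \; map_rel S)%relation j.+1 (x, z).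
  elim: j z => [|j IH] z gz.
    by exists x => //; exists (S x) => //; exact: good_step gx gz.
  have [w gw] := good_ex j.+1; exists w; first exact: IH.
  by exists (S w) => //; exact: good_step gw gz.
by exists N => //=; case: N N0 gy {ay} => // N _ /chain.
Qed.

End shadowing.

Section chain_transitivity.
Context {R : realType} {X : metricType R} {F : set (X * X)}.
Hypotheses (compactX : compact [set: X]) (closedF : closed F).
Hypotheses (surjF : rel_surjective F).
Hypothesis chainF : chain_transitive (@mdist R X) F.

Let sub_jump (e : R) : 0 < e -> F `<=` jump (F := F) e.
Proof.
by move=> e0 [x y] Fxy; exists y => //; rewrite /dist_rel /= mdistxx.
Qed.

Let chain_path (e : R) u v : 0 < e -> exists k f,
  [/\ (0 < k)%N, f 0%N = u, f k = v &
    forall n : nat, jump (F := F) e (f n, f n.+1)].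
Proof.
move=> e0; have [succF _] := rel_surjectiveP surjF.
have : chain_rel (@mdist R X) F (u, v) by rewrite chainF.
move=> /(_ e e0)[k /= k0 uv].
have [|f [f0 fk jf]] := path_extend _ uv.
  by move=> x; have [y xy] := succF x; exists y; exact: sub_jump.
by exists k, f.
Qed.

(** The pseudo-orbit follows [x] up to time [n], then a chain in [X] from there
    to the start of [y], then [y]. *)
Lemma fwd_chain_transitive (d : fwd_orbits F -> fwd_orbits F -> R) :
  compatible_metric d -> chain_transitive d (map_rel (fwd_shift F)).
Proof.
move=> dP; apply/seteqP; split=> // -[x y] _ eps /= eps0.
have [n|//|//|n [e e0 chain]] := @pseudo_orbit_chain _ X F nat compactX closedF
  succn id _ _ (fwd_shift F) d _ dP eps eps0.
  by exists (iota 0 n.+1) => i; rewrite mem_iota.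
pose x' := x : orbits succn F; pose y' := y : orbits succn F.
have [k [f [k0 f0 fk jf]]] := chain_path (coord x' n) (coord y' 0%N) e0.
have tail := splice_orbit fk (fun n _ => jf n)
  (fun i => sub_jump e0 (coordP y' i)).
have f0' : coord x' n = splice k f (coord y') 0%N by rewrite splice_left.
have jx i : jump (F := F) e (coord x' i, coord x' i.+1).
  exact: sub_jump e0 _ (coordP x' i).
apply: (chain _ x y (n + k)%N _ (splice_orbit f0' (fun i _ => jx i) tail)).
- by rewrite addn_gt0 k0 orbT.
- by move=> i ni; rewrite splice_left.
- by move=> i ni; rewrite iter_succn addnC -addnA !splice_right.
Qed.

(** Here the chain in [X] leads from [x] at time [n] to [y] at time [- n], so
    that the final shift of the pseudo-orbit agrees with [y] on both sides. *)
Lemma bi_chain_transitive (d : bi_orbits F -> bi_orbits F -> R) :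
  compatible_metric d -> chain_transitive d (map_rel (bi_shift F)).
Proof.
move=> dP; apply/seteqP; split=> // -[x y] _ eps /= eps0.
pose succz (i : int) := i + 1.
have [n|i|//|n [e e0 chain]] := @pseudo_orbit_chain _ X F int compactX closedF
  succz absz _ _ (bi_shift F) d _ dP eps eps0.
- exists ([seq Posz i | i <- iota 0 n.+1] ++ [seq - Posz i | i <- iota 0 n.+1]).
  move=> i ni; rewrite mem_cat; apply/orP; case: (lerP 0 i) => i0.
    by left; apply/mapP; exists `|i|%N; rewrite ?mem_iota//; lia.
  by right; apply/mapP; exists `|i|%N; rewrite ?mem_iota//; lia.
- by rewrite /succz; lia.
pose x' := x : orbits succz F; pose y' := y : orbits succz F.
have [k [f [k0 f0 fk jf]]] := chain_path (coord x' n) (coord y' (- n%:Z)) e0.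
pose g i := coord y' (- n%:Z + i%:Z).
have fg : f k = g 0%N by rewrite fk /g addr0.
have jg i : jump (F := F) e (g i, g i.+1).
  rewrite /g -addn1 PoszD addrA; exact: sub_jump e0 _ (coordP y' _).
have tail := splice_orbit fg (fun n _ => jf n) jg.
have f0' : coord x' n = splice k f g 0%N by rewrite splice_left.
have jx i : jump (F := F) e (coord x' i, coord x' (i + 1)).
  exact: sub_jump e0 _ (coordP x' i).
apply: (chain _ x y (n + k + n)%N _
  (bi_splice_orbit f0' (fun i _ => jx i) tail)).
- by lia.
- by move=> i ni; rewrite bi_splice_left//; lia.
- move=> i ni; rewrite iter_succz.
  have -> : i + (n + k + n)%:Z = n%:Z + (k + `|(i + n%:Z)%R|)%:Z by lia.
  by rewrite bi_splice_right// splice_right// /g; congr (coord _ _); lia.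
Qed.

End chain_transitivity.

(** * Minimal sets *)

Section minimal.
Context {T : topologicalType} {F : set (T * T)}.
Hypotheses (compactT : compact [set: T]) (closedF : closed F).

Lemma closed_predecessors x : closed [set u | F (u, x)].
Proof.
apply: (closed_preimage (f := fun u => (u, x))) closedF.
by apply: pair_continuous => u; [exact: cvg_id|exact: cvg_cst].
Qed.

Lemma closed_successors x : closed [set y | F (x, y)].
Proof.
apply: (closed_preimage (f := fun y => (x, y))) closedF.
by apply: pair_continuous => u; [exact: cvg_cst|exact: cvg_id].
Qed.

(** The limit set of [C]: the points that can be reached by arbitrarily long
    paths inside [C]. By compactness a point of it has a predecessor in it, and
    every successor in [C] of such a point is again one. *)
Lemma viable_core C : closed C -> C !=set0 ->
  (forall x, C x -> exists2 y, C y & F (x, y)) ->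
  exists D, [/\ D !=set0, viable F D & D `<=` C].
Proof.
move=> cC C0 CF.
pose fix K n := if n is n'.+1 then C `&` rel_image F (K n') else C.
have KC n : K n `<=` C by case: n => [//|n] x [].
have cK n : closed (K n).
  elim: n => [//|n IH]; apply: closedI => //; exact: closed_rel_image.
have decK n : K n.+1 `<=` K n.
  elim: n => [|n IH] x [Cx //] /rel_imageP[u Ku Fux]; split=> //.
  by apply/rel_imageP; exists u => //; exact: IH.
have K0 n : K n !=set0.
  elim: n => [//|n [x Kx]]; have [y Cy Fxy] := CF _ (KC _ _ Kx).
  by exists y; split=> //; apply/rel_imageP; exists x.
exists [set x | forall n, K n x]; split.
- exact: decreasing_bigcap_nonempty.
- split.
    have -> : [set x | forall n, K n x] = \bigcap_n K n.
      by apply/seteqP; split=> x Kx n; [move=> _; exact: Kx|exact: (Kx n)].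
    exact: closed_bigI.
  move=> x Kx; split; apply/rel_imageP.
    have [|n u [Ku Fu]|n|u Ku] := @decreasing_bigcap_nonempty _
        (fun n => K n `&` [set u | F (u, x)]) compactT.
    + by move=> n; apply: closedI => //; exact: closed_predecessors.
    + by split=> //; exact: decK.
    + by have [_ /rel_imageP[u Ku Fux]] := Kx n.+1; exists u.
    by exists u => [n|]; have [] := Ku 0%N; [have [] := Ku n|].
  have [y Cy Fxy] := CF x (Kx 0%N); exists y => // -[//|n].
  by split=> //; apply/rel_imageP; exists x.
- by move=> x /(_ 0%N).
Qed.

(** By compactness again: the successors of a point of the intersection in the
    various members form a totally ordered family of nonempty closed sets, and
    so do its predecessors. *)
Lemma viable_bigcap (P : set (set T)) : P !=set0 -> total_on P subset ->
  (forall A, P A -> A !=set0 /\ viable F A) ->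
  (\bigcap_(A in P) A) !=set0 /\ viable F (\bigcap_(A in P) A).
Proof.
have chain G (Q : set (set T)) : closed G -> Q !=set0 -> total_on Q subset ->
    (forall A, Q A -> closed A /\ (A `&` G) !=set0) ->
    exists2 x, G x & forall A, Q A -> A x.
  move=> cG [A0 QA0] totQ QG.
  have [|_ _ [A QA <-] [B QB <-]|_ [A QA <-]|_ [A QA <-]|x xQ] :=
      @chain_bigcap_nonempty _ [set A `&` G | A in Q] compactT.
  - by exists (A0 `&` G); exists A0.
  - by have [AB|BA] := totQ _ _ QA QB; [left|right]; exact: setSI.
  - by apply: closedI => //; have [] := QG _ QA.
  - by have [] := QG _ QA.
  exists x => [|A QA]; first by have [|_] := xQ (A0 `&` G); first by exists A0.
  by have [|] := xQ (A `&` G); first by exists A.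
move=> P0 totP PV; split.
  have [A PA|x _ xP] := chain setT P closedT P0 totP.
    by rewrite setIT; have [A0 [cA _]] := PV A PA.
  by exists x.
split; first by apply: closed_bigI => A /PV[_ []].
move=> x Px; split; apply/rel_imageP.
  have [|A PA|u Fux uP] := chain [set u | F (u, x)] P _ P0 totP.
  - exact: closed_predecessors.
  - have [A0 [cA AF]] := PV A PA; split=> //.
    by have [/rel_imageP[u Au Fux] _] := AF x (Px A PA); exists u.
  by exists u.
have [|A PA|y Fxy yP] := chain [set y | F (x, y)] P _ P0 totP.
- exact: closed_successors.
- have [A0 [cA AF]] := PV A PA; split=> //.
  by have [_ /rel_imageP[y Ay Fxy]] := AF x (Px A PA); exists y.
by exists y.
Qed.

(** Zorn's lemma, stated for increasing unions, is applied to the complements in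
    [C] of the nonempty viable subsets; the empty union corresponds to [C]. *)
Lemma exists_minimal C : C !=set0 -> viable F C ->
  exists2 M, minimal F M & M `<=` C.
Proof.
move=> C0 vC.
pose P A := (C `\` A) !=set0 /\ viable F (C `\` A).
have [Q PQ totQ|A [[A0 vA] maxA]] := @Zorn_bigcup _ P.
  have [->|/set0P Q0] := eqVneq Q set0; first by rewrite /P bigcup_set0 setD0.
  have := @viable_bigcap [set C `\` A | A in Q].
  have -> : \bigcap_(B in [set C `\` A | A in Q]) B = C `\` \bigcup_(A in Q) A.
    rewrite bigcap_image; apply/seteqP; split=> x.
      move=> CQx; split=> [|[A QA Ax]]; last by have [_] := CQx A QA.
      by have [A QA] := Q0; have [] := CQx A QA.
    by move=> [Cx nQx] A QA; split=> // Ax; apply: nQx; exists A.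
  apply.
  - by have [A QA] := Q0; exists (C `\` A); exists A.
  - move=> _ _ [A QA <-] [B QB <-].
    have [AB|AB] := totQ _ _ QA QB; [right|left] => x [Cx nx];
      by split=> // /AB.
  - by move=> _ [A QA <-]; exact: PQ.
exists (C `\` A); last exact: subDsetl.
split=> // D D0 vD DA; apply/seteqP; split=> // x [Cx nAx].
apply: contrapT => nDx.
apply: (maxA (~` D)).
  split=> [y Ay Dy|/(_ x nDx)//].
  by have [] := DA y Dy.
rewrite /P (_ : C `\` ~` D = D)//.
by rewrite setDE setCK; apply/setIidPr => y /DA[].
Qed.

Lemma closed_restr B : closed B -> closed (rel_restr F B).
Proof.
move=> cB; apply: closedI => //; apply: closedI.
  by apply: closed_preimage cB => ?; exact: cvg_fst.
by apply: closed_preimage cB => ?; exact: cvg_snd.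
Qed.

(** Otherwise an orbit could avoid [U] forever, and its limit points would form
    a smaller viable set. *)
Lemma minimal_forced B U : minimal F B -> open U -> (B `&` U) !=set0 ->
  exists2 x, B x & forall y, rel_restr F B (x, y) -> U y.
Proof.
move=> [_ [cB BF] minB] oU [x0 [Bx0 Ux0]]; apply: contrapT => /forall2NP H.
have esc x : B x -> exists2 y, (B `\` U) y & F (x, y).
  move=> Bx; have [//|/existsNP[y /not_implyP[[Fxy [_ By]] nUy]]] := H x.
  by exists y.
have [||x [Bx _]|D [D0 vD DB]] := viable_core (C := B `\` U).
- by rewrite setDE; apply: closedI => //; exact: open_closedC.
- by have [y By _] := esc _ Bx0; exists y.
- exact: esc.
have DE : D = B by apply: minB => // x /DB[].
by have [] : (B `\` U) x0 by apply: DB; rewrite DE.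
Qed.

End minimal.

Section synchronised.
Context {R : realType} {X : metricType R} {F : set (X * X)} {B : set X}.
Hypotheses (compactX : compact [set: X]) (closedF : closed F).
Hypothesis minB : minimal F B.

(** Pull small balls back with [minimal_forced]: in [U] every orbit in [B] is
    forced through one and the same finite sequence of small balls. *)
Lemma synchronised (e : R) L : 0 < e -> exists U : set X,
  [/\ open U, (B `&` U) !=set0 & forall f g : nat -> X,
    (forall n, rel_restr F B (f n, f n.+1)) ->
    (forall n, rel_restr F B (g n, g n.+1)) ->
    U (f 0%N) -> U (g 0%N) ->
    forall j, (j <= L)%N -> mdist (f j) (g j) <= e].
Proof.
move=> e0; have e2 : 0 < e / 2 by rewrite divr_gt0.
pose ballU (b : X) := [set y | mdist b y < e / 2].
have oball b : open (ballU b) by exact: (open_dist_ball (mdist_compatible X)).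
have ball_le b x y : ballU b x -> ballU b y -> mdist x y <= e.
  move=> bx yb; have := metric_triangle x b y; rewrite (metric_sym x b).
  by move: bx yb; rewrite /ballU /=; lra.
have [[b0 Bb0] [cB _] _] := minB.
elim: L => [|L [U [oU BU UL]]].
  exists (ballU b0); split=> //.
    by exists b0; split=> //; rewrite /ballU /= mdistxx.
  by move=> f g _ _ fU gU j; rewrite leqn0 => /eqP ->; exact: ball_le fU gU.
have [x Bx Ux] := minimal_forced compactX closedF minB oU BU.
exists ([set x | forall y, rel_restr F B (x, y) -> U y] `&` ballU x); split.
- apply: openI => //; apply: open_rel_core => //; exact: closed_restr.
- by exists x; split=> //; split=> //; rewrite /ballU /= mdistxx.
move=> f g Ff Fg [f1 fx] [g1 gx] [_|j jL]; first exact: ball_le fx gx.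
apply: (UL (fun n => f n.+1) (fun n => g n.+1)) => //.
- exact: f1.
- exact: g1.
Qed.

End synchronised.

Section minimal_lift.
Context {R : realType} {X : metricType R} {F : set (X * X)} {I : eqType}.
Hypotheses (compactX : compact [set: X]) (closedF : closed F).
Context {s : I -> I} {S : orbits s F -> orbits s F} (Ss : is_shift S).
Variables (i0 : I) (sz : I -> nat).
(** Some shift brings the window of size [n] into the future of [i0]. *)
Hypothesis window_future : forall n, exists t L, forall i, (sz i <= n)%N ->
  exists2 j, (j <= L)%N & iter t s i = iter j s i0.
Context {B : set X} (minB : minimal F B).

Let cY : compact [set: orbits s F]. Proof. exact: compact_orbits. Qed.

Let closedS : closed (map_rel S). Proof. exact: closed_shift. Qed.

Let viable_shift M z : viable (map_rel S) M -> M z -> M (S z).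
Proof.
by move=> [_ vM] /vM[_ /rel_imageP[w Mw]]; rewrite /map_rel /= => <-.
Qed.

Let viable_iter M z n : viable (map_rel S) M -> M z -> M (iter n S z).
Proof. by move=> vM Mz; elim: n => [//|n IH]; exact: viable_shift. Qed.

Let viable_unshift M z n : viable (map_rel S) M -> M z ->
  exists2 w, M w & iter n S w = z.
Proof.
move=> vM; elim: n z => [|n IH] z Mz; first by exists z.
have [_ /(_ z Mz)[/rel_imageP[w Mw wz] _]] := vM.
by have [v Mv vw] := IH w Mw; exists v => //=; rewrite vw.
Qed.

Definition lift_of (M : set (orbits s F)) : Prop :=
  minimal (map_rel S) M /\ (fun x => coord x i0) @` M = B.

Let lift_coord M z i : lift_of M -> M z -> B (coord z i).
Proof.
move=> [[_ vM _] MB] Mz; have [t [L H]] := window_future (sz i).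
have [w Mw <-] := viable_unshift t vM Mz.
have [j _ ij] := H i (leqnn _).
rewrite (coord_iter_shift Ss) ij -(coord_iter_shift Ss) -MB.
by exists (iter j S w) => //; exact: viable_iter.
Qed.

(** A minimal subset of the orbits in [B] is a lift, because its projection is
    viable. *)
Lemma lift_exists : (exists x : orbits s F, forall i, B (coord x i)) ->
  exists M, lift_of M.
Proof.
move=> [x0 Bx0]; have [_ [cB BF] minB'] := minB.
have [||x Ex|D [D0 vD DE]] := viable_core cY closedS
    (C := [set x : orbits s F | forall i, B (coord x i)]).
- have -> : [set x : orbits s F | forall i, B (coord x i)] =
      \bigcap_i (fun x : orbits s F => coord x i) @^-1` B.
    by apply/seteqP; split=> x Bx i; [move=> _; exact: Bx|exact: (Bx i)].
  apply: closed_bigI => i _.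
  by apply: closed_preimage cB; exact: coord_continuous.
- by exists x0.
- by exists (S x) => // i; rewrite Ss.
have [M minM MD] := exists_minimal cY closedS D0 vD.
exists M; split=> //; have [[z Mz] vM _] := minM; apply: minB'.
- by exists (coord z i0); exists z.
- split.
    apply: (closed_image cY _ (@coord_continuous _ _ _ s F i0)).
      exact: metric_hausdorff.
    by case: vM.
  move=> _ [w Mw <-]; split; apply/rel_imageP.
    have [v Mv <-] := viable_unshift 1 vM Mw.
    by exists (coord v i0); [exists v|rewrite /= Ss; exact: coordP].
  exists (coord (S w) i0); first by exists (S w) => //; exact: viable_shift.
  by rewrite /= Ss; exact: coordP.
- by move=> _ [w /MD/DE Bw <-]; exact: Bw.
Qed.

(** Distinct lifts are disjoint, hence separated on some window. But both
    project onto [B], so both contain an orbit that starts at the point given by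
    [synchronised], and these two remain close for as long as the window
    requires. *)
Lemma lift_unique M1 M2 : lift_of M1 -> lift_of M2 -> M1 = M2.
Proof.
move=> l1 l2; have [[_ v1 min1] M1B] := l1; have [[_ v2 min2] M2B] := l2.
have [c1 _] := v1; have [c2 _] := v2.
have [[z0 Mz0]|M0] := pselect ((M1 `&` M2) !=set0).
  have [||z [z1 z2]|D [D0 vD DM]] := viable_core cY closedS (C := M1 `&` M2).
  - exact: closedI.
  - by exists z0.
  - by exists (S z) => //; split; exact: viable_shift.
  have <- : D = M1 by apply: min1 => // x /DM[].
  by apply: min2 => // x /DM[].
exfalso.
have [|z [z1 z2]|n nC] :=
    @window_separates _ _ _ s F compactX closedF sz (M1 `*` M2).
- apply: closedI.
    by apply: closed_preimage c1 => ?; exact: cvg_fst.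
  by apply: closed_preimage c2 => ?; exact: cvg_snd.
- by apply: M0; exists z.
have [t [L H]] := window_future n.
have e0 : 0 < n.+1%:R^-1 :> R by rewrite invr_gt0 ltr0n.
have [U [_ [x [Bx Ux]] sync]] := synchronised compactX closedF minB L e0.
have [z Mz zx] : ((fun x => coord x i0) @` M1) x by rewrite M1B.
have [w Mw wx] : ((fun x => coord x i0) @` M2) x by rewrite M2B.
apply: (nC (iter t S z) (iter t S w)); first by split; exact: viable_iter.
have orbB M u (l : lift_of M) : M u -> forall n,
    rel_restr F B (coord u (iter n s i0), coord u (iter n.+1 s i0)).
  by move=> Mu k; split; [exact: coordP|split; exact: lift_coord l Mu].
move=> i ni; rewrite !(coord_iter_shift Ss); have [j jL ->] := H i ni.
apply: (sync _ _ (orbB _ _ l1 Mz) (orbB _ _ l2 Mw)) => //=; first by rewrite zx.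
by rewrite wx.
Qed.

Lemma unique_lift : (exists x : orbits s F, forall i, B (coord x i)) ->
  exists! A : set (orbits s F),
    A `<=` set_val @^-1` orbits s (rel_restr F B) /\ unique lift_of A.
Proof.
move=> /lift_exists[M lM].
have MB : M `<=` set_val @^-1` orbits s (rel_restr F B).
  by move=> z Mz i; split; [exact: coordP|split; exact: lift_coord lM Mz].
exists M; split.
  by split=> //; split=> // M'; exact: lift_unique.
by move=> M' [_ [lM' _]]; exact: lift_unique.
Qed.

End minimal_lift.

Section orbits_in.
Context {R : realType} {X : metricType R} {F : set (X * X)} {B : set X}.
Hypothesis minB : minimal F B.

(** [F] inside [B] and everything outside: a relation without dead ends whose
    orbits cannot cross the boundary of [B]. *)
Let G : set (X * X) := [set xy | B xy.1 \/ B xy.2 -> rel_restr F B xy].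

Let succG x : exists y, G (x, y).
Proof.
have [_ [_ BF] _] := minB; have [Bx|nBx] := pselect (B x).
  by have [_ /rel_imageP[y By Fxy]] := BF x Bx; exists y.
by exists x => /= -[].
Qed.

Let predG x : exists y, G (y, x).
Proof.
have [_ [_ BF] _] := minB; have [Bx|nBx] := pselect (B x).
  by have [/rel_imageP[y By Fyx] _] := BF x Bx; exists y.
by exists x => /= -[].
Qed.

Lemma fwd_orbit_in : exists x : orbits succn F, forall i, B (coord x i).
Proof.
have [[b Bb] _ _] := minB; have [f f0 Gf] := fwd_extend succG b.
have Bf n : B (f n).
  by elim: n => [|n Bn]; [rewrite f0|have [_ []] := Gf n (or_introl Bn)].
have [x xE] := @coord_orbit _ _ _ succn F f
  (fun n => (Gf n (or_introl (Bf n))).1).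
by exists x; rewrite xE.
Qed.

Lemma bi_orbit_in :
  exists x : orbits (fun i : int => i + 1) F, forall i, B (coord x i).
Proof.
have [[b Bb] _ _] := minB; have [f f0 Gf] := bi_extend succG predG 0 b.
have Bf i : B (f i).
  elim/int_ind: i => [|n Bn|n Bn]; first by rewrite f0.
    by have [_ []] := Gf n%:Z (or_introl Bn); rewrite -PoszD addn1.
  have := Gf (- n.+1%:Z); have -> : - n.+1%:Z + 1 = - n%:Z by lia.
  by move=> /(_ (or_intror Bn))[_ []].
have [x xE] := @coord_orbit _ _ _ (fun i : int => i + 1) F f
  (fun n => (Gf n (or_introl (Bf n))).1).
by exists x; rewrite xE.
Qed.

End orbits_in.

Theorem theorem2p64 (R : realType) (X : metricType R) (F : set (X * X))
    (compactX : compact [set: X]) (closedF : closed F)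
    (surjF : rel_surjective F) :
  [/\
    (forall G : set (fwd_orbits F),
      inward (map_rel (fwd_shift F)) G ->
      exists (U : set X) (N : nat),
        [/\ inward F U,
            (0 < N)%N,
            well_inside (rel_image (rel_pow (map_rel (fwd_shift F)) N) G)
              (fwd_proj F 0%N @^-1` U),
            well_inside (fwd_proj F 0%N @^-1` U) G &
            fwd_proj F 0%N @^-1` attractor F U =
              attractor (map_rel (fwd_shift F)) G]),
    (forall G : set (bi_orbits F),
      inward (map_rel (bi_shift F)) G ->
      exists (U : set X) (N m : nat),
        [/\ inward F U,
            (0 < N)%N /\ (0 < m)%N,
            well_inside (rel_image (rel_pow (map_rel (bi_shift F)) N) G)
              (bi_proj F (- m%:Z) @^-1` U),
            well_inside (bi_proj F (- m%:Z) @^-1` U) G &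
            attractor (map_rel (bi_shift F)) G =
              set_val @^-1` bi_orbits (rel_restr F (attractor F U))]),
    (chain_transitive (@mdist R X) F ->
      (forall d : fwd_orbits F -> fwd_orbits F -> R,
        compatible_metric d -> chain_transitive d (map_rel (fwd_shift F))) /\
      (forall d : bi_orbits F -> bi_orbits F -> R,
        compatible_metric d -> chain_transitive d (map_rel (bi_shift F)))) &
    (forall B : set X, minimal F B ->
      (exists! A : set (fwd_orbits F),
        A `<=` set_val @^-1` fwd_orbits (rel_restr F B) /\
        unique (fun M : set (fwd_orbits F) =>
          minimal (map_rel (fwd_shift F)) M /\ fwd_proj F 0%N @` M = B) A) /\
      (exists! A : set (bi_orbits F),
        A `<=` set_val @^-1` bi_orbits (rel_restr F B) /\
        unique (fun M : set (bi_orbits F) =>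
          minimal (map_rel (bi_shift F)) M /\ bi_proj F 0 @` M = B) A))].
Proof.
split.
- by move=> G; exact: fwd_inward.
- by move=> G; exact: bi_inward.
- by move=> chainF; split=> d dP;
    [exact: fwd_chain_transitive|exact: bi_chain_transitive].
move=> B minB; split.
  apply: (unique_lift compactX closedF (S := fwd_shift F : orbits succn F -> _)
    _ (i0 := 0%N) (sz := id) _ minB (fwd_orbit_in minB)) => // n.
  by exists 0%N, n => i ni; exists i; rewrite ?iter_succn// addn0.
apply: (unique_lift compactX closedF
  (S := bi_shift F : orbits (fun i : int => i + 1) F -> _)
  _ (i0 := 0) (sz := absz) _ minB (bi_orbit_in minB)) => // n.
exists n, (n + n)%N => i ni; exists `|(i + n%:Z)%R|%N; first by lia.
by rewrite !iter_succz; lia.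
Qed.
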